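(* Let $\lambda$ be a nonzero real number. For integers $n\ge 0$ and real (or indeterminate) $x$ let $(x)_{0,\mu}=1$ and $(x)_{n,\mu}=x(x-\mu)\cdots(x-(n-1)\mu)$ for $n\ge1$, for any nonzero parameter $\mu$. Define the degenerate Eulerian polynomials with parameter $\mu$ by $\sum_{j=0}^{\infty}(j+1)_{n,\mu}x^{j}=\frac{A_{n,\mu}(x)}{(1-x)^{n+1}}$ for $|x|<1$, and the degenerate Eulerian numbers by $A_{n,\mu}(x)=\sum_{k=0}^{n}A_{\mu}(n,k)x^{k}$. Then for every $n\ge0$, \[\sum_{k=0}^{n}\binom{x+k}{n}A_{-\lambda}(n,k)=(x)_{n,\lambda}.\]
   Context: $A_{-\lambda}(n,k)$ is the degenerate Eulerian number with parameter $\mu=-\lambda$; $\binom{x+k}{n}=(x+k)(x+k-1)\cdots(x+k-n+1)/n!$ as a polynomial in $x$. *)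

(* Defs.v *)
From HB Require Import structures.
From mathcomp Require Import all_boot all_order all_algebra.
From mathcomp Require Import all_classical all_reals all_analysis.
Set Implicit Arguments.
Unset Strict Implicit.
Unset Printing Implicit Defensive.
Import Order.TTheory GRing.Theory Num.Theory.
Import numFieldNormedType.Exports.
Local Open Scope classical_set_scope.
Local Open Scope ring_scope.

(* (x)_{n,mu}; S is the reals, or real polynomials when x is an
   indeterminate. *)
Definition degenerate_falling (S : comNzRingType) (mu x : S) (n : nat) : S :=
  \prod_(i < n) (x - i%:R * mu).

(* In S = {poly R} over a field of characteristic 0, n`!%:R is a nonzero
   constant polynomial, hence a unit, so the division is a genuine one. *)
Definition gen_binomial (S : comUnitRingType) (y : S) (n : nat) : S :=
  (\prod_(i < n) (y - i%:R)) / n`!%:R.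

Definition is_degenerate_eulerian_poly (R : realType) (mu : R) (n : nat)
    (A : {poly R}) : Prop :=
  (size A <= n.+1)%N /\
  forall x : R, `|x| < 1 ->
    series (fun j : nat => degenerate_falling mu j.+1%:R n * x ^+ j) @ \oo
      --> A.[x] / (1 - x) ^+ n.+1.

(* A_{n,mu}, by definite description: two polynomials with this property agree
   on ]-1, 1[, hence are equal. *)
Definition degenerate_eulerian_poly (R : realType) (mu : R) (n : nat) :
    {poly R} :=
  xget 0 [set A : {poly R} | is_degenerate_eulerian_poly mu n A].

Definition degenerate_eulerian (R : realType) (mu : R) (n k : nat) : R :=
  (degenerate_eulerian_poly mu n)`_k.

(* Main.v *)
(* The degenerate Worpitzky identity has a purely algebraic solution: since
   (x - c) C(x+k, n) is a combination of C(x+k, n+1) and C(x+k+1, n+1),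
   induction on n yields a polynomial A of size at most n+1 with
   sum_k C(x+k, n) A_k = (x)_{n,lambda} for all x.  Putting x = -(j+1) turns
   this into (j+1)_{n,-lambda} = sum_k A_k C(j+n-k, n), and the negative
   binomial series sum_j C(j+n-k, n) x^j = x^k / (1-x)^{n+1} shows that A
   satisfies the defining property of the degenerate Eulerian polynomial, which
   determines it uniquely. *)
Require Import Defs.
From HB Require Import structures.
From mathcomp Require Import all_boot all_order all_algebra.
From mathcomp Require Import all_classical all_reals all_analysis.
From mathcomp Require Import ring zify.
Import Order.TTheory GRing.Theory Num.Theory.
Import numFieldNormedType.Exports.
Local Open Scope ring_scope.

Lemma degenerate_fallingS (S : comNzRingType) (mu x : S) (n : nat) :
  degenerate_falling mu x n.+1 = degenerate_falling mu x n * (x - n%:R * mu).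
Proof. exact: big_ord_recr. Qed.

Lemma gen_binomialS (R : numFieldType) (y : R) (n : nat) :
  gen_binomial y n.+1 = gen_binomial y n * (y - n%:R) / n.+1%:R.
Proof.
rewrite /gen_binomial big_ord_recr /= factS natrM.
have n1 : n%:R + 1 != 0 :> R by rewrite natr1 pnatr_eq0.
have nf : n`!%:R != 0 :> R by rewrite pnatr_eq0 -lt0n fact_gt0.
by rewrite -[n.+1%:R]natr1; field; rewrite n1 nf.
Qed.

Lemma gen_binomialDS (R : numFieldType) (y : R) (n : nat) :
  gen_binomial (y + 1) n.+1 = gen_binomial y n * (y + 1) / n.+1%:R.
Proof.
rewrite /gen_binomial big_ord_recl /= factS natrM subr0.
under eq_bigr => i _ do rewrite /bump /= natrD opprD addrA addrK.
have n1 : n%:R + 1 != 0 :> R by rewrite natr1 pnatr_eq0.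
have nf : n`!%:R != 0 :> R by rewrite pnatr_eq0 -lt0n fact_gt0.
by rewrite -[n.+1%:R]natr1; field; rewrite n1 nf.
Qed.

(** Both binomials of order [n.+1] are the one of order [n] times a linear factor, x+k-n or x+k+1,
    over n+1; the weights are those that combine these two factors into (n+1)(x-c). *)
Lemma mul_gen_binomial (R : numFieldType) (c x : R) (n k : nat) :
  (x - c) * gen_binomial (x + k%:R) n =
  (k.+1%:R + c) * gen_binomial (x + k%:R) n.+1 +
  (n%:R - k%:R - c) * gen_binomial (x + k.+1%:R) n.+1.
Proof.
rewrite -natr1 addrA gen_binomialDS gen_binomialS.
have n1 : n%:R + 1 != 0 :> R by rewrite natr1 pnatr_eq0.
by rewrite -[n.+1%:R]natr1; field.
Qed.

Lemma degenerate_worpitzky (R : numFieldType) (lambda : R) (n : nat) :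
  exists2 A : {poly R}, (size A <= n.+1)%N &
  forall x : R, \sum_(k < n.+1) gen_binomial (x + k%:R) n * A`_k =
                degenerate_falling lambda x n.
Proof.
elim: n => [|n [A sA IH]].
  exists 1 => [|x]; first by rewrite size_poly1.
  rewrite big_ord1 coef1 /= mulr1 /gen_binomial /degenerate_falling !big_ord0.
  by rewrite fact0 divr1.
(* The new factor is x - c. Each old term k contributes [f k] at index k and [g k] at index k+1; for
   lambda = 0 this is the classical Eulerian recurrence. *)
pose c : R := n%:R * lambda.
pose f k := (k.+1%:R + c) * A`_k.
pose g k := (n%:R - k%:R - c) * A`_k.
exists (\poly_(k < n.+2) (f k + if k is k'.+1 then g k' else 0)) => [|x].
  exact: size_poly.
rewrite degenerate_fallingS -IH mulr_suml.
under eq_bigr => k _ do rewrite coef_poly ltn_ord mulrDr.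
(* The top term of the [f] sum and the bottom term of the shifted [g] sum vanish, so both run over k
   <= n. *)
rewrite big_split /= big_ord_recr /= [f n.+1]/f.
have -> : A`_n.+1 = 0 by rewrite nth_default.
rewrite !mulr0 addr0 [X in _ + X]big_ord_recl /= mulr0 add0r -big_split /=.
apply: eq_bigr => k _; rewrite /f /g /bump /= add1n add0n -/c.
transitivity ((x - c) * gen_binomial (x + k%:R) n * A`_k); last by ring.
by rewrite mul_gen_binomial; ring.
Qed.

Lemma gen_binomial_negative (R : numFieldType) (n k j : nat) : (k <= n)%N ->
  gen_binomial (- j.+1%:R + k%:R) n = (- 1) ^+ n * 'C(j + n - k, n)%:R :> R.
Proof.
move=> kn; have nf : n`!%:R != 0 :> R by rewrite pnatr_eq0 -lt0n fact_gt0.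
apply: (mulIf nf); rewrite divfK // -mulrA -natrM bin_ffact.
have [kj|jk] := leqP k j; last first.
  rewrite ffact_small ?mulr0; last by lia.
  have lt : (k - j.+1 < n)%N by lia.
  (* For j < k the factor at i = k-j-1 is zero. *)
  rewrite (bigD1 (Ordinal lt)) //= natrB // [_ + k%:R]addrC subrr mul0r //.
rewrite ffact_prod natr_prod -[X in (- 1) ^+ X](card_ord n) -prodr_const.
(* Reversing the order matches the factors, up to sign, with the descending ones of the falling
   factorial of j+n-k. *)
rewrite (reindex_inj rev_ord_inj) -big_split /=; apply: eq_bigr => i _.
have lt_in := ltn_ord i.
have -> : (j + n - k - i = j.+1 - k + (n - i.+1))%N by lia.
rewrite natrD !natrB //; [ring | lia].
Qed.

Lemma degenerate_fallingN (S : comNzRingType) (mu x : S) (n : nat) :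
  degenerate_falling (- mu) (- x) n = (- 1) ^+ n * degenerate_falling mu x n.
Proof.
rewrite /degenerate_falling -[X in (- 1) ^+ X](card_ord n) -prodr_const.
by rewrite -big_split; apply: eq_bigr => i _ /=; ring.
Qed.

Lemma poly_eq_on_unit_ball (R : numFieldType) (p q : {poly R}) :
  (forall x : R, `|x| < 1 -> p.[x] = q.[x]) -> p = q.
Proof.
move=> pq; apply/eqP; rewrite -subr_eq0.
(* The points 1/(i+2) are distinct, lie in the ball, and are too many to be roots of a nonzero
   [p - q]. *)
pose rs : seq R := [seq i.+2%:R^-1 | i <- iota 0 (size (p - q))].
apply/eqP/(@roots_geq_poly_eq0 _ _ rs).
- apply/allP => _ /mapP[i _ ->]; rewrite /root !hornerE pq ?subrr//.
  by rewrite ger0_norm ?invr_ge0// invf_lt1 ?ltr1n// ltr0n.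
- rewrite map_inj_uniq ?iota_uniq// => i j /invr_inj/eqP.
  by rewrite eqr_nat => /eqP[].
- by rewrite size_map size_iota.
Qed.

Definition negbinom_term {R : realType} (n : nat) (x : R) : R^nat :=
  fun j => 'C(j + n, n)%:R * x ^+ j.

Lemma series_negbinom0 (R : realType) (N : nat) (x : R) :
  (1 - x) * series (negbinom_term 0 x) N = 1 - x ^+ N.
Proof.
elim: N => [|N IH]; first by rewrite /series /= big_geq// mulr0 subrr.
rewrite seriesSr mulrDr IH /negbinom_term bin0 exprS; ring.
Qed.

(** By Pascal's rule, multiplying by 1-x lowers the order by one; truncation at N leaves a boundary
    term. *)
Lemma series_negbinomS (R : realType) (n N : nat) (x : R) :
  (1 - x) * series (negbinom_term n.+1 x) N =
  series (negbinom_term n x) N - 'C(N + n, n.+1)%:R * x ^+ N.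
Proof.
elim: N => [|N IH].
  by rewrite /series /= !big_geq// bin_small// mul0r subrr mulr0.
rewrite !seriesSr mulrDr IH /negbinom_term addSn addnS binS natrD exprS; ring.
Qed.

Lemma negbinom_term_ge0 (R : realType) (n j : nat) (x : R) :
  0 <= x -> 0 <= negbinom_term n x j.
Proof. by move=> x0; rewrite mulr_ge0 ?exprn_ge0. Qed.

Lemma series_negbinom_le (R : realType) (n N : nat) (x : R) : 0 <= x -> x < 1 ->
  series (negbinom_term n x) N <= ((1 - x) ^+ n.+1)^-1.
Proof.
move=> x0 x1; have y0 : 0 < 1 - x by rewrite subr_gt0.
elim: n => [|n IH].
  rewrite expr1 -[leRHS]mulr1 ler_pdivlMl// series_negbinom0.
  by rewrite lerBlDr lerDl exprn_ge0.
rewrite exprS invfM ler_pdivlMl// series_negbinomS (le_trans _ IH)//.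
by rewrite lerBlDr lerDl mulr_ge0 ?exprn_ge0.
Qed.

(** At |x| the partial sums are monotone and bounded, hence convergent, so the terms tend to 0. No
    growth estimate for the binomials is required. *)
Lemma cvg_negbinom_term0 (R : realType) (n : nat) (x : R) : `|x| < 1 ->
  (negbinom_term n x @ \oo --> 0)%classic.
Proof.
move=> x1; apply: norm_cvg0.
have -> : (fun j => `|negbinom_term n x j|) = negbinom_term n `|x|.
  by apply/funext => j; rewrite normrM normr_nat normrX.
apply: cvg_series_cvg_0; apply: nondecreasing_is_cvgn.
  apply/nondecreasing_seqP => N; rewrite seriesSr lerDl.
  exact: negbinom_term_ge0.
by exists ((1 - `|x|) ^+ n.+1)^-1 => _ [N _ <-]; exact: series_negbinom_le.
Qed.

Lemma cvg_series_negbinom (R : realType) (n : nat) (x : R) : `|x| < 1 ->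
  (series (negbinom_term n x) @ \oo --> ((1 - x) ^+ n.+1)^-1)%classic.
Proof.
move=> x1; have y0 : 1 - x != 0.
  by rewrite subr_eq0 eq_sym; apply: contraTneq x1 => ->; rewrite normr1 ltxx.
elim: n => [|n IH].
  have -> : series (negbinom_term 0 x) = fun N => (1 - x)^-1 * (1 - x ^+ N).
    by apply/funext => N; rewrite -series_negbinom0 mulKf.
  rewrite expr1 -[X in (_ --> X)%classic]mulr1; apply: cvgMr.
  rewrite -[X in (_ --> X)%classic]subr0; apply: cvgB; first exact: cvg_cst.
  exact: cvg_expr.
have -> : series (negbinom_term n.+1 x) =
    fun N => (1 - x)^-1 *
             (series (negbinom_term n x) N - 'C(N + n, n.+1)%:R * x ^+ N).
  by apply/funext => N; rewrite -series_negbinomS mulKf.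
rewrite exprS invfM; apply: cvgMr.
rewrite -[X in (_ --> X)%classic]subr0; apply: cvgB => //.
(* The boundary term is dominated by the series term of order [n.+1], as C(N+n, n+1) <= C(N+n+1,
   n+1). *)
apply: norm_cvg0; apply: (@squeeze_cvgr _ _ _ _ (cst 0)
  (fun N => `|negbinom_term n.+1 x N|)).
- apply: nearW => N; rewrite normr_ge0 !normrM !normr_nat ler_wpM2r//.
  by rewrite ler_nat addnS leq_bin2l.
- exact: cvg_cst.
- by apply/norm_cvg0P; exact: cvg_negbinom_term0.
Qed.

(* As k <= n, the natural subtraction j + n - k is exact, and the terms with
   j < k vanish. *)
Lemma cvg_series_shifted_negbinom (R : realType) (n k : nat) (x : R) :
  (k <= n)%N -> `|x| < 1 ->
  (series (fun j => 'C(j + n - k, n)%:R * x ^+ j) @ \oo -->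
   x ^+ k / (1 - x) ^+ n.+1)%classic.
Proof.
move=> kn x1; rewrite -(cvg_shiftn k).
have -> : (fun N => series (fun j => 'C(j + n - k, n)%:R * x ^+ j) (N + k)%N) =
    fun N => x ^+ k * series (negbinom_term n x) N.
  apply/funext => N; rewrite /series /= (@big_cat_nat _ _ _ k) ?leq_addl//=.
  rewrite big_nat_cond big1 ?add0r => [|j /andP[/andP[_ jk] _]]; last first.
    by rewrite bin_small ?mul0r//; lia.
  rewrite -{1}[k]add0n big_addn addnK mulr_sumr; apply: eq_bigr => j _.
  rewrite /negbinom_term exprD addnAC addnK; ring.
by apply: cvgMr; exact: cvg_series_negbinom.
Qed.

Lemma is_degenerate_eulerian_poly_worpitzky (R : realType) (lambda : R)
    (n : nat) (A : {poly R}) : (size A <= n.+1)%N ->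
  (forall x : R, \sum_(k < n.+1) gen_binomial (x + k%:R) n * A`_k =
                 degenerate_falling lambda x n) ->
  is_degenerate_eulerian_poly (- lambda) n A.
Proof.
move=> sA AE; split=> // x x1.
have -> : series (fun j => degenerate_falling (- lambda) j.+1%:R n * x ^+ j) =
    fun N => \sum_(k < n.+1)
      A`_k * series (fun j => 'C(j + n - k, n)%:R * x ^+ j) N.
  apply/funext => N; rewrite /series /=.
  under [RHS]eq_bigr => k _ do rewrite mulr_sumr.
  rewrite exchange_big; apply: eq_bigr => j _ /=.
  (* Evaluation at -(j+1): the sign (-1)^n produced here cancels the one from
     [gen_binomial_negative]. *)
  rewrite -[j.+1%:R]opprK degenerate_fallingN -AE mulr_sumr mulr_suml.
  apply: eq_bigr => k _; rewrite gen_binomial_negative -1?ltnS//.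
  by rewrite !mulrA -exprMn mulrNN mulr1 expr1n mul1r mulrAC mulrC mulrA.
rewrite (horner_coef_wide _ sA) mulr_suml.
under eq_bigr => k _ do rewrite -mulrA.
apply: cvg_big => //; first exact: add_continuous.
move=> k _; apply: cvgMr; apply: cvg_series_shifted_negbinom => //.
by rewrite -ltnS.
Qed.

(** The chosen polynomial and [A] give limits of the same series; uniqueness of limits and
    cancelling the power of 1-x make them agree on the ball. *)
Lemma degenerate_eulerian_polyP (R : realType) (mu : R) (n : nat)
    (A : {poly R}) : is_degenerate_eulerian_poly mu n A ->
  degenerate_eulerian_poly mu n = A.
Proof.
move=> AP; rewrite /degenerate_eulerian_poly; case: xgetP => [B _ BP|/(_ A)//].
apply: poly_eq_on_unit_ball => x x1.
have y0 : ((1 - x) ^+ n.+1)^-1 != 0.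
  rewrite invr_eq0 expf_neq0// subr_eq0 eq_sym.
  by apply: contraTneq x1 => ->; rewrite normr1 ltxx.
apply: (mulIf y0); exact: cvg_unique (BP.2 x x1) (AP.2 x x1).
Qed.

Theorem theorem2p7 (R : realType) (lambda : R) (lambda_neq0 : lambda != 0)
    (n : nat) :
  (forall x : R,
     \sum_(k < n.+1)
        gen_binomial (x + k%:R) n * degenerate_eulerian (- lambda) n k
     = degenerate_falling lambda x n)
  /\
  \sum_(k < n.+1)
     gen_binomial ('X + k%:R) n * (degenerate_eulerian (- lambda) n k)%:P
  = degenerate_falling lambda%:P 'X n.
Proof.
have [A sA AE] := degenerate_worpitzky _ lambda n.
have realE x : \sum_(k < n.+1)
    gen_binomial (x + k%:R) n * degenerate_eulerian (- lambda) n k =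
    degenerate_falling lambda x n.
  have AP := is_degenerate_eulerian_poly_worpitzky _ _ _ _ sA AE.
  by rewrite -AE /degenerate_eulerian (degenerate_eulerian_polyP _ _ _ _ AP).
(* The identity in the indeterminate follows from the real one by evaluating both sides. *)
split=> //; apply: poly_eq_on_unit_ball => x _.
transitivity (degenerate_falling lambda x n); last first.
  rewrite /degenerate_falling horner_prod; apply: eq_bigr => i _.
  by rewrite !hornerE hornerMn !hornerE.
rewrite -realE horner_sum; apply: eq_bigr => k _.
(* The inverse of the constant polynomial n! is the constant 1/n!, so evaluation commutes with the
   division. *)
rewrite hornerM hornerC /gen_binomial -(polyC_natr _ n`!) polyCV hornerM hornerC.
congr (_ / _ * _); rewrite horner_prod; apply: eq_bigr => i _.
by rewrite !hornerE !hornerMn !hornerE.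
Qed.
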